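(* Let $T_5(n)=(5n+1)/2$ for odd $n$ and $T_5(n)=n/2$ for even $n$. For an integer $n$ let $t^-(n)=\inf\{|T_5^{(k)}(n)|:k\ge0\}$. Then $$\liminf_{n\to\infty}\frac{\log t^-(n)}{\log n}=0 .$$
   Context: $T_5^{(k)}$ denotes the $k$-th iterate of $T_5$ (with $T_5^{(0)}(n)=n$); the liminf is over positive integers $n\to\infty$. *)

(* Defs.v *)
From Stdlib Require Import ZArith Reals.
From Coquelicot Require Import Coquelicot.

(* Both divisions are exact, on negative integers too. *)
Definition T5 (n : Z) : Z :=
  if Z.odd n then ((5 * n + 1) / 2)%Z else (n / 2)%Z.

(* [Inf_seq] is never infinite here: the set is nonempty and bounded below
   by 0, so [real] only removes the [Finite] constructor. *)
Definition tminus (n : Z) : R :=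
  real (Inf_seq (fun k : nat => IZR (Z.abs (Nat.iter k T5 n)))).

(* Main.v *)
Require Import Defs.
From Stdlib Require Import ZArith Reals Lia Lra.
From Coquelicot Require Import Coquelicot.

(** The quotient is nonnegative because [T5] preserves positive integers, and
    it vanishes at the powers of 2, whose orbits descend to 1 by halving alone. *)

Lemma Inf_seq_le_term (u : nat -> Rbar) (k : nat) :
  Rbar_le (Inf_seq u) (u k).
Proof.
  apply (is_inf_seq_glb u _ (Inf_seq_correct u)); now exists k.
Qed.

Lemma le_Inf_seq (u : nat -> Rbar) (m : Rbar) :
  (forall k, Rbar_le m (u k)) -> Rbar_le m (Inf_seq u).
Proof.
  intros Hm; apply (is_inf_seq_glb u _ (Inf_seq_correct u)).
  now intros x [k ->].
Qed.

Lemma is_finite_Inf_seq (u : nat -> R) (m : R) :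
  (forall k, (m <= u k)%R) -> is_finite (Inf_seq u).
Proof.
  intros Hm.
  assert (Hlow : Rbar_le m (Inf_seq u)) by now apply le_Inf_seq.
  pose proof (Inf_seq_le_term u 0) as Hup.
  now destruct (Inf_seq u).
Qed.

Lemma is_LimInf_seq_frequently_le (u : nat -> R) (l : R) :
  eventually (fun n => (l <= u n)%R) ->
  (forall N, exists n, (N <= n)%nat /\ (u n <= l)%R) ->
  is_LimInf_seq u l.
Proof.
  intros [N Hge] Hfreq [e He]; simpl; split.
  - intros M; destruct (Hfreq M) as [n [Hn Hle]].
    exists n; split; [exact Hn | lra].
  - exists N; intros n Hn; specialize (Hge n Hn); lra.
Qed.

Lemma ln_nonneg (x : R) : (1 <= x)%R -> (0 <= ln x)%R.
Proof.
  intros Hx; rewrite <- ln_1; apply ln_le; lra.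
Qed.

Lemma ln_pos (x : R) : (1 < x)%R -> (0 < ln x)%R.
Proof.
  intros Hx; rewrite <- ln_1; apply ln_increasing; lra.
Qed.

Lemma T5_pos (n : Z) : (0 < n)%Z -> (0 < T5 n)%Z.
Proof.
  intros Hn; unfold T5; destruct (Z.odd n) eqn:Hodd.
  - apply Z.div_str_pos; lia.
  - assert (n <> 1%Z) by (intros ->; discriminate).
    apply Z.div_str_pos; lia.
Qed.

Lemma iter_T5_pos (k : nat) (n : Z) : (0 < n)%Z -> (0 < Nat.iter k T5 n)%Z.
Proof.
  apply (Nat.iter_invariant k Z T5 (Z.lt 0)), T5_pos.
Qed.

Lemma T5_double (n : Z) : T5 (2 * n) = n.
Proof.
  unfold T5; rewrite Z.odd_even, Z.mul_comm; apply Z.div_mul; lia.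
Qed.

Lemma iter_T5_pow2_mul (k : nat) (n : Z) :
  Nat.iter k T5 (2 ^ Z.of_nat k * n)%Z = n.
Proof.
  induction k as [|k IH]; [apply Z.mul_1_l|].
  rewrite Nat.iter_succ_r, Nat2Z.inj_succ, Z.pow_succ_r by lia.
  now rewrite <- Z.mul_assoc, T5_double.
Qed.

Lemma is_finite_Inf_seq_abs_iter_T5 (n : Z) :
  is_finite (Inf_seq (fun k : nat => IZR (Z.abs (Nat.iter k T5 n)))).
Proof.
  apply (is_finite_Inf_seq _ 0); intros k; apply IZR_le; lia.
Qed.

Lemma tminus_le_abs_iter (n : Z) (k : nat) :
  (tminus n <= IZR (Z.abs (Nat.iter k T5 n)))%R.
Proof.
  change (Rbar_le (Finite (tminus n)) (IZR (Z.abs (Nat.iter k T5 n)))).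
  unfold tminus; rewrite is_finite_Inf_seq_abs_iter_T5.
  apply (Inf_seq_le_term (fun j => Finite (IZR (Z.abs (Nat.iter j T5 n))))).
Qed.

Lemma le_tminus (n : Z) (m : R) :
  (forall k, (m <= IZR (Z.abs (Nat.iter k T5 n)))%R) -> (m <= tminus n)%R.
Proof.
  intros Hm; change (Rbar_le m (Finite (tminus n))).
  unfold tminus; rewrite is_finite_Inf_seq_abs_iter_T5.
  now apply le_Inf_seq.
Qed.

Lemma tminus_ge_1 (n : Z) : (0 < n)%Z -> (1 <= tminus n)%R.
Proof.
  intros Hn; apply le_tminus; intros k; apply IZR_le.
  pose proof (iter_T5_pos k n Hn); lia.
Qed.

Lemma tminus_pow2_mul_le (k : nat) (n : Z) :
  (tminus (2 ^ Z.of_nat k * n) <= IZR (Z.abs n))%R.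
Proof.
  rewrite <- (iter_T5_pow2_mul k n) at 2; apply tminus_le_abs_iter.
Qed.

Lemma tminus_pow2 (k : nat) : tminus (2 ^ Z.of_nat k) = 1%R.
Proof.
  apply Rle_antisym.
  - rewrite <- (Z.mul_1_r (2 ^ _)); apply (tminus_pow2_mul_le k 1).
  - apply tminus_ge_1, Z.pow_pos_nonneg; lia.
Qed.

Theorem theorem7p4 :
  LimInf_seq (fun n : nat => (ln (tminus (Z.of_nat n)) / ln (INR n))%R)
  = Finite 0%R.
Proof.
  apply is_LimInf_seq_unique, is_LimInf_seq_frequently_le.
  - exists 2%nat; intros n Hn; apply Rdiv_le_0_compat.
    + apply ln_nonneg, tminus_ge_1; lia.
    + apply ln_pos, lt_1_INR; lia.
  - intros N; exists (2 ^ N)%nat; split.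
    + apply Nat.lt_le_incl, Nat.pow_gt_lin_r; lia.
    + rewrite Nat2Z.inj_pow, tminus_pow2, ln_1, Rdiv_0_l; lra.
Qed.
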